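(* For any $\alpha\in\mathbb C$ and any $n\in\mathbb N_0$, the following identities hold: $$\nabla_nL_n^{(\alpha)}(x)=L_n^{(\alpha-1)}(x),$$ $$\alpha L_n^{(\alpha)}(x)-(n+1)\Delta_nL_n^{(\alpha)}(x)=xL_n^{(\alpha+1)}(x),$$ $$\alpha L_n^{(\alpha)}(x)-(n+\alpha)\nabla_nL_n^{(\alpha)}(x)=xL_{n-1}^{(\alpha+1)}(x),$$ $$\nabla_\alpha L_n^{(\alpha)}(x)=L_{n-1}^{(\alpha)}(x),$$ $$(n+\alpha-x)L_n^{(\alpha)}(x)-(\alpha+n)\nabla_\alpha L_n^{(\alpha)}(x)=(n+1)L_{n+1}^{(\alpha-1)}(x),$$ $$(n+1+\alpha-x)L_n^{(\alpha)}(x)-x\Delta_\alpha L_n^{(\alpha)}(x)=(n+1)L_{n+1}^{(\alpha)}(x).$$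
   Context: $\mathbb N_0=\{0,1,2,\dots\}$; $(a)_n=a(a+1)\cdots(a+n-1)$. The Laguerre polynomials are $$L_n^{(\alpha)}(x)=\frac{(\alpha+1)_n}{n!}\,{}_1F_1(-n;\alpha+1;x)=\sum_{j=0}^n\frac{(\alpha+j+1)_{n-j}}{(n-j)!\,j!}(-x)^j,$$ with $L_{-1}^{(\alpha)}=0$. The operators are $\Delta_nf(n)=f(n+1)-f(n)$, $\nabla_nf(n)=f(n)-f(n-1)$, $\Delta_\alpha f(\alpha)=f(\alpha+1)-f(\alpha)$, $\nabla_\alpha f(\alpha)=f(\alpha)-f(\alpha-1)$, the other variables being fixed. *)

(* Defs.v *)
From mathcomp Require Import all_boot all_order all_algebra.
Set Implicit Arguments.
Unset Strict Implicit.
Unset Printing Implicit Defensive.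

Import Order.TTheory GRing.Theory Num.Theory.
Local Open Scope ring_scope.

(* The step is the unit of the argument type, so the same operators act on the
   degree, of type int, and on the parameter of a Laguerre polynomial. *)
Definition fdiff (T : pzRingType) (V : zmodType) (f : T -> V) (t : T) : V :=
  f (t + 1) - f t.

Definition bdiff (T : pzRingType) (V : zmodType) (f : T -> V) (t : T) : V :=
  f t - f (t - 1).

Definition pochhammer (K : pzRingType) (a : K) (n : nat) : K :=
  \prod_(i < n) (a + i%:R).

(* The explicit sum makes sense for every parameter a, whereas
   (a+1)_n / n! * 1F1(-n; a+1; x) is undefined at some negative integers a. *)
Definition laguerre_nat (K : numFieldType) (n : nat) (a x : K) : K :=
  \sum_(j < n.+1)
    pochhammer (a + j%:R + 1) (n - j) / ((n - j)`!%:R * j`!%:R) * (- x) ^+ j.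

(* Only the value 0 at degree -1 is a convention of the theory; the degrees
   below -1 are given the same value to obtain a total function. *)
Definition laguerre (K : numFieldType) (n : int) (a x : K) : K :=
  match n with
  | Posz m => laguerre_nat m a x
  | Negz _ => 0
  end.

(* Main.v *)
Require Import Defs.
From mathcomp Require Import all_boot all_order all_algebra.
From mathcomp Require Import reals.
From mathcomp Require Import complex.
From mathcomp Require Import ring.
Import GRing.Theory Num.Theory.
Local Open Scope ring_scope.
Local Open Scope complex_scope.

(** All six identities follow from two contiguity relations:
      (A)  L_n^(a) = L_n^(a-1) + L_(n-1)^(a),
      (B)  (n+1+a) L_n^(a) = (n+1) L_(n+1)^(a) + x L_n^(a+1).
    Relation (A) is the first and the fourth identity at once.  In each of the
    other four, (A) turns every difference into values of L, and what is left
    is a combination of the instances of (B) at the parameters a and a-1.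

    Both relations are checked on the coefficients c_n(j,a) of (-x)^j.
    Relation (A) is Pascal's rule for (b)_k / k!.  For (B), the factor n+1 of
    c_(n+1)(j,a) is split as (n+1-j) + j: the first summand cancels the top
    factor of (n+1-j)! and leaves (n+1+a) c_n(j,a); the second cancels the top
    factor of j! and leaves c_n(j-1,a+1), which is the coefficientwise form of
    x d/dx L_(n+1)^(a) = - x L_n^(a+1). *)

Section Contiguity.

Variable K : numFieldType.
Implicit Types (a b x : K) (n k j : nat).

Lemma pochhammer0 b : pochhammer b 0 = 1.
Proof. by rewrite /pochhammer big_ord0. Qed.

Lemma pochhammerSr b k :
  pochhammer b k.+1 = pochhammer b k * (b + k%:R).
Proof. by rewrite /pochhammer big_ord_recr. Qed.

Lemma pochhammerSl b k :
  pochhammer b k.+1 = b * pochhammer (b + 1) k.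
Proof.
rewrite /pochhammer big_ord_recl addr0; congr (_ * _).
by apply: eq_bigr => i _; rewrite lift0 -natr1 addrA addrAC.
Qed.

Lemma fact_neq0 k : k`!%:R != 0 :> K.
Proof. by rewrite pnatr_eq0 -lt0n fact_gt0. Qed.

Lemma succ_neq0 k : k%:R + 1 != 0 :> K.
Proof. by rewrite natr1 pnatr_eq0. Qed.

(** The analogue for (b)_k / k! of Pascal's rule for binomial coefficients:
    (b+1)_(k+1) = (b+1+k) (b+1)_k and (b)_(k+1) = b (b+1)_k, so the difference
    is (k+1) (b+1)_k. *)
Lemma pochhammer_fact_pascal b k :
  pochhammer (b + 1) k.+1 / k.+1`!%:R
  = pochhammer b k.+1 / k.+1`!%:R + pochhammer (b + 1) k / k`!%:R.
Proof.
rewrite pochhammerSr pochhammerSl factS natrM -natr1.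
by field; rewrite fact_neq0 succ_neq0.
Qed.

Definition laguerre_coef n a j : K :=
  pochhammer (a + j%:R + 1) (n - j) / ((n - j)`!%:R * j`!%:R).

Lemma laguerre_coef_pascal n a j : (j <= n)%N ->
  laguerre_coef n.+1 (a + 1) j
  = laguerre_coef n.+1 a j + laguerre_coef n (a + 1) j.
Proof.
move=> le_jn; rewrite /laguerre_coef subSn // !invfM !mulrA -mulrDl.
have -> : a + 1 + j%:R + 1 = a + j%:R + 1 + 1 by ring.
by rewrite pochhammer_fact_pascal.
Qed.

Lemma laguerre_coef_diag n a : laguerre_coef n a n = (n`!%:R)^-1.
Proof. by rewrite /laguerre_coef subnn pochhammer0 fact0 !mul1r. Qed.

(** With k = n - j, the last factor of (a+j+1)_(k+1) is a+j+1+k = n+1+a, which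
    does not depend on j; this is why the relation sums to one for L itself. *)
Lemma laguerre_coef_degree n a j : (j <= n)%N ->
  (n.+1 - j)%:R * laguerre_coef n.+1 a j
  = (n%:R + 1 + a) * laguerre_coef n a j.
Proof.
move=> le_jn; rewrite /laguerre_coef subSn // pochhammerSr factS natrM -natr1.
rewrite natrB //; field.
by rewrite !fact_neq0 -natrB // succ_neq0.
Qed.

(** The coefficientwise form of d/dx L_(n+1)^(a) = - L_n^(a+1): the Pochhammer
    symbols on the two sides are the same, so only j+1 and (j+1)! interact. *)
Lemma laguerre_coef_deriv n a j :
  j.+1%:R * laguerre_coef n.+1 a j.+1 = laguerre_coef n (a + 1) j.
Proof.
rewrite /laguerre_coef subSS factS natrM -natr1.
have -> : a + (j%:R + 1) + 1 = a + 1 + j%:R + 1 by ring.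
by field; rewrite !fact_neq0 succ_neq0.
Qed.

Lemma laguerre_nat_pascal n a x :
  laguerre_nat n.+1 (a + 1) x = laguerre_nat n.+1 a x + laguerre_nat n (a + 1) x.
Proof.
rewrite /laguerre_nat.
(* The leading coefficient (-1)^(n+1) / (n+1)! does not depend on a. *)
rewrite big_ord_recr [in RHS]big_ord_recr /= -!/(laguerre_coef _ _ _).
rewrite !laguerre_coef_diag addrAC -big_split; congr (_ + _).
apply: eq_bigr => j _ /=; rewrite -mulrDl; congr (_ * _).
by apply: laguerre_coef_pascal; rewrite -ltnS.
Qed.

(** Relation (B), obtained by writing the factor n+1 of the j-th coefficient of
    L_(n+1)^(a) as (n+1-j) + j.  The first part has no term at j = n+1 and the
    second none at j = 0, so each sum ranges over the coefficients of a
    polynomial of degree n. *)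
Lemma laguerre_nat_contiguous n a x :
  (n%:R + 1 + a) * laguerre_nat n a x
  = (n%:R + 1) * laguerre_nat n.+1 a x + x * laguerre_nat n (a + 1) x.
Proof.
have degree_part :
  \sum_(j < n.+2) (n.+1 - j)%:R * laguerre_coef n.+1 a j * (- x) ^+ j
  = (n%:R + 1 + a) * laguerre_nat n a x.
  rewrite big_ord_recr /= subnn !mul0r addr0 mulr_sumr.
  apply: eq_bigr => j _.
  by rewrite laguerre_coef_degree ?mulrA // -ltnS.
have deriv_part :
  \sum_(j < n.+2) j%:R * laguerre_coef n.+1 a j * (- x) ^+ j
  = - (x * laguerre_nat n (a + 1) x).
  rewrite big_ord_recl !mul0r add0r -mulNr mulr_sumr.
  apply: eq_bigr => j _.
  by rewrite lift0 laguerre_coef_deriv exprS mulrCA.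
rewrite -degree_part -[x * _]opprK -deriv_part; apply/eqP.
rewrite eq_sym subr_eq -big_split natr1 mulr_sumr; apply/eqP.
apply: eq_bigr => j _ /=.
by rewrite -!mulrDl -natrD subnK ?mulrA // -ltnS.
Qed.

Lemma laguerre_pascal n a x :
  laguerre n%:Z a x = laguerre n%:Z (a - 1) x + laguerre (n%:Z - 1) a x.
Proof.
case: n => [|n].
  (* In degree 0 the relation reads 1 = 1 + L_(-1), with L_(-1) = 0. *)
  by rewrite /= addr0 /laguerre_nat !big_ord1 !pochhammer0.
have -> : n.+1%:Z - 1 = n%:Z by rewrite -addn1 PoszD addrK.
by have := laguerre_nat_pascal n (a - 1) x; rewrite subrK.
Qed.

Lemma laguerre_contiguous n a x :
  (n%:R + 1 + a) * laguerre n%:Z a x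
  = (n%:R + 1) * laguerre (n%:Z + 1) a x + x * laguerre n%:Z (a + 1) x.
Proof. by rewrite -PoszD addn1; apply: laguerre_nat_contiguous. Qed.

(** Of the seven values of L in these identities, pascal, pascalSn and
    pascalSa express three (P, Sm and Pp) by the others.  The two instances of
    (B) express the products x * Lp and x * L; once these are substituted, both
    sides are linear in the four values that are left and agree as ring
    expressions. *)
Lemma laguerre_difference_identities n (alpha x : K) :
  bdiff (fun m : int => laguerre m alpha x) n%:Z = laguerre n%:Z (alpha - 1) x
  /\
  alpha * laguerre n%:Z alpha x
    - (n%:R + 1) * fdiff (fun m : int => laguerre m alpha x) n%:Z
  = x * laguerre n%:Z (alpha + 1) x
  /\
  alpha * laguerre n%:Z alpha x
    - (n%:R + alpha) * bdiff (fun m : int => laguerre m alpha x) n%:Z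
  = x * laguerre (n%:Z - 1) (alpha + 1) x
  /\
  bdiff (fun a : K => laguerre n%:Z a x) alpha
  = laguerre (n%:Z - 1) alpha x
  /\
  (n%:R + alpha - x) * laguerre n%:Z alpha x
    - (alpha + n%:R) * bdiff (fun a : K => laguerre n%:Z a x) alpha
  = (n%:R + 1) * laguerre (n%:Z + 1) (alpha - 1) x
  /\
  (n%:R + 1 + alpha - x) * laguerre n%:Z alpha x
    - x * fdiff (fun a : K => laguerre n%:Z a x) alpha
  = (n%:R + 1) * laguerre (n%:Z + 1) alpha x.
Proof.
rewrite /bdiff /fdiff.
have pascal := laguerre_pascal n alpha x.
(* Relation (A) in degree n+1, and in degree n at the parameter alpha + 1. *)
have pascalSn : laguerre (n%:Z + 1) alpha x
    = laguerre (n%:Z + 1) (alpha - 1) x + laguerre n%:Z alpha x.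
  by have := laguerre_pascal n.+1 alpha x; rewrite -addn1 PoszD addrK.
have pascalSa : laguerre n%:Z (alpha + 1) x
    = laguerre n%:Z alpha x + laguerre (n%:Z - 1) (alpha + 1) x.
  by have := laguerre_pascal n (alpha + 1) x; rewrite addrK.
have contig := laguerre_contiguous n alpha x.
have contig_pred := laguerre_contiguous n (alpha - 1) x.
rewrite subrK in contig_pred.
move: pascal pascalSn pascalSa contig contig_pred.
set L := laguerre n%:Z alpha x.
set Lm := laguerre n%:Z (alpha - 1) x.
set Lp := laguerre n%:Z (alpha + 1) x.
set P := laguerre (n%:Z - 1) alpha x.
set Pp := laguerre (n%:Z - 1) (alpha + 1) x.
set S := laguerre (n%:Z + 1) alpha x.
set Sm := laguerre (n%:Z + 1) (alpha - 1) x.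
move=> pascal pascalSn pascalSa contig contig_pred.
have P_def : P = L - Lm by rewrite pascal addrC addKr.
have Pp_def : Pp = Lp - L by rewrite pascalSa addrC addKr.
have Sm_def : Sm = S - L by rewrite pascalSn addrK.
have xLp : x * Lp = (n%:R + 1 + alpha) * L - (n%:R + 1) * S.
  by rewrite contig addrC addKr.
have xL : x * L = (n%:R + alpha) * Lm - (n%:R + 1) * Sm.
  have -> : n%:R + alpha = n%:R + 1 + (alpha - 1) by ring.
  by rewrite contig_pred addrC addKr.
split; first by rewrite P_def; ring.
split; first by rewrite xLp; ring.
split.
  by rewrite Pp_def [x * _]mulrBr xLp xL P_def Sm_def; ring.
split; first by rewrite P_def.
split.
  by rewrite mulrBl xL; ring.
by rewrite [x * _]mulrBr xLp mulrBl; ring.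
Qed.

End Contiguity.

Theorem lemma4p1 (R : realType) (alpha : R[i]) (n : nat) (x : R[i]) :
  bdiff (fun m : int => laguerre m alpha x) n%:Z = laguerre n%:Z (alpha - 1) x
  /\
  alpha * laguerre n%:Z alpha x
    - (n%:R + 1) * fdiff (fun m : int => laguerre m alpha x) n%:Z
  = x * laguerre n%:Z (alpha + 1) x
  /\
  alpha * laguerre n%:Z alpha x
    - (n%:R + alpha) * bdiff (fun m : int => laguerre m alpha x) n%:Z
  = x * laguerre (n%:Z - 1) (alpha + 1) x
  /\
  bdiff (fun a : R[i] => laguerre n%:Z a x) alpha
  = laguerre (n%:Z - 1) alpha x
  /\
  (n%:R + alpha - x) * laguerre n%:Z alpha x
    - (alpha + n%:R) * bdiff (fun a : R[i] => laguerre n%:Z a x) alpha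
  = (n%:R + 1) * laguerre (n%:Z + 1) (alpha - 1) x
  /\
  (n%:R + 1 + alpha - x) * laguerre n%:Z alpha x
    - x * fdiff (fun a : R[i] => laguerre n%:Z a x) alpha
  = (n%:R + 1) * laguerre (n%:Z + 1) alpha x.
Proof.
exact: laguerre_difference_identities.
Qed.
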